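(* Let $\Phi=(A;\{E_i\}_{i=0}^d;A^*;\{E^*_i\}_{i=0}^d)$ be a tridiagonal system on $V$ with diameter $d\ge 1$, such that $(A,A^* )$ satisfies the $q$-Serre relations, with eigenvalue sequence $\{\theta_i\}_{i=0}^d=\{q^{2i-d}\}_{i=0}^d$ and dual eigenvalue sequence $\{\theta^*_i\}_{i=0}^d=\{q^{d-2i}\}_{i=0}^d$. Let $\{U_i\}_{i=0}^d$ be its split decomposition and let $K:V\to V$ be the linear map acting on $U_i$ as $q^{d-2i}I$ for $0\le i\le d$. For a scalar $t\in\mathcal K$ put $B=A$ and $B^*=tA^*+(1-t)K$, let $E'_i$ be the primitive idempotent of $B^*$ for the eigenvalue $\theta^*_i$, and let $\Phi'=(B;\{E_i\}_{i=0}^d;B^*;\{E'_i\}_{i=0}^d)$. Let $\{\zeta_i\}_{i=0}^d$ be the split sequence of $\Phi$ and $P(x)=\sum_{i=0}^d \frac{(-1)^i\zeta_i x^i}{([i]^!_q)^2}$ its Drinfel'd polynomial. Then the following are equivalent: (i) $(B,B^* )$ is a tridiagonal pair on $V$; (ii) $\Phi'$ is a tridiagonal system; (iii) $t\neq 0$ and $P\!\left(\frac{t}{(q-q^{-1})^2}\right)\neq 0$. Moreover, if (i)–(iii) hold, then $\Phi'$ has eigenvalue sequence $\{\theta_i\}_{i=0}^d$, dual eigenvalue sequence $\{\theta^*_i\}_{i=0}^d$ and split sequence $\{t^i\zeta_i\}_{i=0}^d$; in particular $\Phi'$ and $(B,B^* )$ have $q$-Serre type (i.e. $B,B^*$ satisfy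 the $q$-Serre relations).
   Context: $\mathcal K$ is an algebraically closed field; $V$ is a nonzero finite-dimensional vector space over $\mathcal K$. $q\in\mathcal K$ is nonzero and not a root of unity; $[i]_q=\frac{q^i-q^{-i}}{q-q^{-1}}$ and $[i]^!_q=\prod_{n=1}^i[n]_q$ (so $[0]^!_q=1$). The $q$-Serre relations for a pair $(X,Y)$ are $X^3Y-[3]_qX^2YX+[3]_qXYX^2-YX^3=0$ and $Y^3X-[3]_qY^2XY+[3]_qYXY^2-XY^3=0$. For a diagonalizable linear map $X$ on $V$ with distinct eigenvalues $\lambda_0,\dots,\lambda_d$, the primitive idempotent for $\lambda_i$ is $\prod_{j\ne i}\frac{X-\lambda_jI}{\lambda_i-\lambda_j}$ (the projection onto the $\lambda_i$-eigenspace along the others). A tridiagonal pair on $V$ is an ordered pair $(A,A^* )$ of linear maps $V\to V$ such that: both are diagonalizable; there is an ordering $V_0,\dots,V_d$ of the eigenspaces of $A$ with $A^*V_i\subseteq V_{i-1}+V_i+V_{i+1}$ ($V_{-1}=V_{d+1}=0$); there is an ordering $V^*_0,\dots,V^*_\delta$ of the eigenspaces of $A^*$ with $AV^*_i\subseteq V^*_{i-1}+V^*_i+V^*_{i+1}$ ($V^*_{-1}=V^*_{\delta+1}=0$); and the only subspaces $W$ with $AW\subseteq W$, $A^*W\subseteq W$ are $0$ and $V$. A tridiagonal system on $V$ is a sequence $(A;\{E_i\}_{i=0}^d;A^*;\{E^*_i\}_{i=0}^d)$ where $A,A^*:V\to V$ are diagonalizable, $\{E_i\}$ is an ordering of the primitive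 idempotents of $A$, $\{E^*_i\}$ is an ordering of the primitive idempotents of $A^*$, $E_iA^*E_j=0$ and $E^*_iAE^*_j=0$ whenever $|i-j|>1$, and the only subspaces invariant under both $A$ and $A^*$ are $0$ and $V$. Its diameter is $d$, its eigenvalue sequence is $\{\theta_i\}$ with $\theta_i$ the eigenvalue of $A$ belonging to $E_i$, and its dual eigenvalue sequence is $\{\theta^*_i\}$ with $\theta^*_i$ the eigenvalue of $A^*$ belonging to $E^*_i$. Split decomposition: $U_i=(E^*_0V+\cdots+E^*_iV)\cap(E_iV+\cdots+E_dV)$; it is known that $V=U_0\oplus\cdots\oplus U_d$ with each $U_i\neq0$, $U_0=E^*_0V$ is one-dimensional, $(A-\theta_iI)U_i\subseteq U_{i+1}$ and $(A^*-\theta^*_iI)U_i\subseteq U_{i-1}$ (with $U_{-1}=U_{d+1}=0$). Split sequence: for a sequence $(A;\{E_i\};A^*;\{E^*_i\})$ with $\dim E^*_0V=1$, let $\tau_i(x)=(x-\theta_0)\cdots(x-\theta_{i-1})$; then $E^*_0\tau_i(A)$ acts on $E^*_0V$ as a scalar $\chi_i$, and the split sequence is $\zeta_i=(\theta^*_0-\theta^*_1)\cdots(\theta^*_0-\theta^*_i)\chi_i$ ($0\le i\le d$). It is a fact (proved in the paper) that $B^*$ is diagonalizable with eigenvalues exactly $\theta^*_0,\dots,\theta^*_d$, so $E'_i$ is well defined. *)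

(* Defs.v *)
(* V = row vectors 'rV[K]_n.+1 (nonzero, finite dim);
   a linear map V -> V is a square matrix acting on the right: v |-> v *m A.
   Subspaces of V are represented by matrices (row spaces, %MS). *)
From HB Require Import structures.
From mathcomp Require Import all_boot all_order all_algebra.
Set Implicit Arguments. Unset Strict Implicit. Unset Printing Implicit Defensive.
Import Order.TTheory GRing.Theory Num.Theory.
Local Open Scope ring_scope.

Section TD.
Variables (K : fieldType) (n : nat).
Local Notation M := 'M[K]_n.+1.

Definition qint (q : K) (i : nat) : K := (q ^+ i - q ^- i) / (q - q^-1).
Definition qfact (q : K) (i : nat) : K := \prod_(1 <= m < i.+1) qint q m.

(* q-Serre relations for (X, Y), written for composition of maps:
   the map X^3 Y (apply Y first) is the matrix Y *m X^3 in the
   right-action convention. *)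
Definition qSerre (q : K) (X Y : M) : Prop :=
  Y *m X *m X *m X - qint q 3 *: (X *m Y *m X *m X)
    + qint q 3 *: (X *m X *m Y *m X) - X *m X *m X *m Y = 0 /\
  X *m Y *m Y *m Y - qint q 3 *: (Y *m X *m Y *m Y)
    + qint q 3 *: (Y *m Y *m X *m Y) - Y *m Y *m Y *m X = 0.

Definition eig_enum (A : M) (d : nat) (lam : nat -> K) : Prop :=
  [/\ (forall i j, (i <= d)%N -> (j <= d)%N -> lam i = lam j -> i = j),
      (forall i, (i <= d)%N -> eigenvalue A (lam i))
    & forall a, eigenvalue A a -> exists2 i, (i <= d)%N & a = lam i].

Definition prim_idem (X : M) (d : nat) (lam : nat -> K) (i : nat) : M :=
  \prod_(j < d.+1 | (j : nat) != i) ((lam i - lam j)^-1 *: (X - (lam j)%:M)).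

Definition irred_pair (A As : M) : Prop :=
  forall W : M, (W *m A <= W)%MS -> (W *m As <= W)%MS ->
    (W == (0 : M))%MS \/ (W == (1%:M : M))%MS.

(* V_i := eigenspace of A for lam_i, with V_{-1} = V_{d+1} = 0 *)
Definition esp (A : M) (d : nat) (lam : nat -> K) (i : nat) : M :=
  if (i <= d)%N then eigenspace A (lam i) else 0.

Definition tridiag_ordering (A As : M) (d : nat) (lam : nat -> K) : Prop :=
  eig_enum A d lam /\
  forall i, (i <= d)%N ->
    (esp A d lam i *m As <=
       (if i == 0%N then (0 : M) else esp A d lam i.-1)
       + esp A d lam i + esp A d lam i.+1)%MS.

Definition TDpair (A As : M) : Prop :=
  [/\ diagonalizable A, diagonalizable As,
      (exists d lam, tridiag_ordering A As d lam),
      (exists delta lams, tridiag_ordering As A delta lams)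
    & irred_pair A As].

Definition idem_ordering (A : M) (d : nat) (E : nat -> M) : Prop :=
  exists2 lam, eig_enum A d lam & forall i, (i <= d)%N -> E i = prim_idem A d lam i.

Definition TDsystem (d : nat) (A : M) (E : nat -> M) (As : M) (Es : nat -> M)
  : Prop :=
  [/\ diagonalizable A /\ diagonalizable As,
      idem_ordering A d E, idem_ordering As d Es,
      (forall i j, (i <= d)%N -> (j <= d)%N -> (j.+1 < i)%N || (i.+1 < j)%N ->
        E i *m As *m E j = 0 /\ Es i *m A *m Es j = 0)
    & irred_pair A As].

Definition eig_seq (d : nat) (A : M) (E : nat -> M) (th : nat -> K) : Prop :=
  forall i, (i <= d)%N -> E i *m A = th i *: E i.

Definition splitU (d : nat) (E Es : nat -> M) (i : nat) : M :=
  ((\sum_(j < i.+1) Es j) :&: (\sum_(i <= j < d.+1) E j))%MS.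

(* split sequence: E*_0 tau_i(A) acts on E*_0 V as chi_i, and
   zeta_i = (ths_0 - ths_1) ... (ths_0 - ths_i) chi_i *)
Definition split_seq (d : nat) (A : M) (Es : nat -> M) (th ths : nat -> K)
  (zeta : nat -> K) : Prop :=
  forall i, (i <= d)%N -> exists chi : K,
    Es 0%N *m (\prod_(j < i) (A - (th j)%:M)) *m Es 0%N = chi *: Es 0%N /\
    zeta i = (\prod_(1 <= j < i.+1) (ths 0%N - ths j)) * chi.

Definition drinfeld (q : K) (d : nat) (zeta : nat -> K) : {poly K} :=
  \sum_(i < d.+1) (((-1) ^+ i * zeta i) / (qfact q i) ^+ 2) *: 'X^i.

End TD.

(* Main.v *)
Require Import Defs.
From HB Require Import structures.
From mathcomp Require Import all_boot all_order all_algebra.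
From mathcomp Require Import ring zify.
Import Order.TTheory GRing.Theory Num.Theory.
Local Open Scope ring_scope.
Set Implicit Arguments. Unset Strict Implicit. Unset Printing Implicit Defensive.

(** Write p_i for the projection onto U_i along the split decomposition, so that
    A = K^-1 + R and As = K + L with R raising and L lowering the grading, and
    Bs = K + t L.

    If t <> 0, conjugation by G = sum_i t^i p_i carries As to Bs, hence Es_i to Es'_i;
    in particular Es'_0 restricted to U_i is t^i Es_0, which gives the split
    sequence t^i zeta_i.  The q-Weyl relations between K and A and between K^-1 and
    As show that K and K^-1 act tridiagonally on the eigenspaces of A and As
    respectively, so the pair (A, Bs) has both tridiagonal relations, and these
    imply the q-Serre relations.  Only irreducibility depends on the polynomial P.

    The Newton expansion of E_0 in the tau_i(A) gives Es'_0 E_0 Es'_0 = c Es'_0 with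
    c = P(t / (q - q^-1)^2).

    - If c <> 0 and W <> 0 is invariant under A and Bs, then the smallest graded
      subspace containing W is invariant under A and As, so it is V and the U_0
      component of W is nonzero.  Applying Es'_0 E_0 to W multiplies this component
      by c, so W contains a nonzero vector of U_0.  The largest graded subspace of
      W is then nonzero, and it is invariant under A and As, so W = V.
    - If c = 0, then E_0 V lies in the kernel of Es'_0, and the sum over i of
      (E_0 V + ... + E_i V) /\ (Es'_{i+1} V + ... + Es'_d V) is a nonzero proper
      invariant subspace.  If t = 0, then U_d is one. *)

(** * Spectral resolutions of diagonalizable matrices *)

Section Resolution.
Variables (F : fieldType) (n : nat).
Local Notation M := 'M[F]_n.+1.

(** The [e i] may be zero here; nonvanishing and injectivity of [lam] are imposed separately. Both
    one-sided eigen-equations are kept so that a block [e i *m Y *m e j] can absorb a factor [X] on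
    either side. *)
Definition resolution (d : nat) (X : M) (lam : nat -> F) (e : nat -> M) : Prop :=
  [/\ forall i, (i <= d)%N -> e i *m X = lam i *: e i,
      forall i, (i <= d)%N -> X *m e i = lam i *: e i,
      forall i j, (i <= d)%N -> (j <= d)%N ->
        e i *m e j = if i == j then e i else 0
    & \sum_(i < d.+1) e i = 1%:M].

Definition inj_upto (d : nat) (lam : nat -> F) : Prop :=
  forall i j, (i <= d)%N -> (j <= d)%N -> lam i = lam j -> i = j.

Lemma eigen_prim_idem m (v : 'M[F]_(m, n.+1)) (X : M) d lam i a :
  v *m X = a *: v ->
  v *m prim_idem X d lam i =
    (\prod_(j < d.+1 | (j : nat) != i) ((lam i - lam j)^-1 * (a - lam j))) *: v.
Proof.
move=> vX; rewrite /prim_idem; elim/big_rec2: _ => [|j c Y _ IH].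
  by rewrite mulmx1 scale1r.
rewrite -mulmxE mulmxA -scalemxAr mulmxBr vX mul_mx_scalar -scalerBl -!scalemxAl.
by rewrite IH !scalerA.
Qed.

(** [prim_idem] is a Lagrange basis polynomial evaluated at [X], so on eigenvectors it acts as a
    Kronecker delta. *)
Lemma eigen_prim_idemE m (v : 'M[F]_(m, n.+1)) (X : M) d lam i j :
  inj_upto d lam -> (i <= d)%N -> (j <= d)%N -> v *m X = lam j *: v ->
  v *m prim_idem X d lam i = if j == i then v else 0.
Proof.
move=> injl id jd vX; rewrite (eigen_prim_idem d lam i vX).
case: (altP (j =P i)) => [->|ji].
  rewrite big1 ?scale1r // => k ki; rewrite mulVf // subr_eq0.
  by apply: contra ki => /eqP/injl -> //; rewrite -ltnS.
rewrite (bigD1 (inord j)) ?inordK //= subrr mulr0 mul0r scale0r //.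
Qed.

Lemma span_ext (I : finType) (S : I -> M) (X Y : M) :
  (1%:M <= \sum_i S i)%MS -> (forall i, S i *m X = S i *m Y) -> X = Y.
Proof.
move=> S1 SXY; apply/eqP; rewrite -subr_eq0 -submx0 -[X - Y]mul1mx.
apply: submx_trans (submxMr _ S1) _; rewrite sumsmxMr.
by apply/sumsmx_subP => i _; rewrite mulmxBr SXY subrr.
Qed.

(** By [span_ext] each identity may be tested on the blocks [S i], where every [prim_idem] acts as 0
    or 1. *)
Lemma resolution_of_span d (X : M) lam (S : nat -> M) :
  inj_upto d lam -> (forall i, (i <= d)%N -> S i *m X = lam i *: S i) ->
  (1%:M <= \sum_(i < d.+1) S i)%MS -> resolution d X lam (prim_idem X d lam).
Proof.
move=> injl SX S1; pose e := prim_idem X d lam; have le (i : 'I_d.+1) := ltn_ord i.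
have Se (i : 'I_d.+1) j : (j <= d)%N -> S i *m e j = if i == j :> nat then S i else 0.
  by move=> jd; rewrite (eigen_prim_idemE injl jd (le i) (SX i (le i))).
split=> [j jd|j jd|j k jd kd|]; apply: (span_ext S1) => i.
- rewrite mulmxA Se // -scalemxAr Se //; case: eqP => [<-|_]; first exact: (SX i (le i)).
  by rewrite mul0mx scaler0.
- rewrite mulmxA (SX i (le i)) -scalemxAl -scalemxAr Se //.
  by case: eqP => [<-|_]; rewrite ?scaler0.
- rewrite mulmxA Se //; case: (altP (j =P k)) => [<-|jk]; rewrite ?Se //.
    by case: ifP => // ij; rewrite ?mul0mx // Se // ij.
  by rewrite mulmx0; case: eqP => [ij|]; rewrite ?mul0mx // Se // ij (negPf jk).
- rewrite mulmx1 mulmx_sumr (bigD1 i) //= (Se i i (le i)) eqxx big1 ?addr0 // => j ji.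
  by rewrite (Se i j (le j)) eq_sym (inj_eq val_inj) (negPf ji).
Qed.

Lemma diagonalizable_resolution d (X : M) lam :
  diagonalizable X -> eig_enum X d lam -> resolution d X lam (prim_idem X d lam).
Proof.
case/diagonalizablePeigen => rs _ rs1 [injl _ enum].
apply: (@resolution_of_span _ _ _ (fun i => eigenspace X (lam i))) => //.
  by move=> i _; apply/eigenspaceP.
rewrite -rs1; elim/big_rec: _ => [|r Y _ sY]; first exact: sub0mx.
rewrite addsmx_sub sY andbT; case: (boolP (eigenvalue X r)) => [/enum[i id ->]|].
  by rewrite (sumsmx_sup (inord i)) // inordK.
by rewrite negbK => /eqP ->; apply: sub0mx.
Qed.

Section Facts.
Variables (d : nat) (X : M) (lam : nat -> F) (e : nat -> M).
Hypothesis res : resolution d X lam e.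

Lemma res_eigl i : (i <= d)%N -> e i *m X = lam i *: e i.
Proof. by case: res => H _ _ _; apply: H. Qed.

Lemma res_eigr i : (i <= d)%N -> X *m e i = lam i *: e i.
Proof. by case: res => _ H _ _; apply: H. Qed.

Lemma res_idem i : (i <= d)%N -> e i *m e i = e i.
Proof. by case: res => _ _ H _ id; rewrite H // eqxx. Qed.

Lemma res_orth i j : (i <= d)%N -> (j <= d)%N -> i != j -> e i *m e j = 0.
Proof. by case: res => _ _ H _ id jd /negPf ij; rewrite H // ij. Qed.

Lemma res_sum : \sum_(i < d.+1) e i = 1%:M.
Proof. by case: res. Qed.

Lemma res_decr m (v : 'M_(m, n.+1)) : v = \sum_(i < d.+1) v *m e i.
Proof. by rewrite -mulmx_sumr res_sum mulmx1. Qed.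

Lemma res_decl m (v : 'M_(n.+1, m)) : v = \sum_(i < d.+1) e i *m v.
Proof. by rewrite -mulmx_suml res_sum mul1mx. Qed.

Lemma res_ext (Y Z : M) :
  (forall i j, (i <= d)%N -> (j <= d)%N -> e i *m Y *m e j = e i *m Z *m e j) ->
  Y = Z.
Proof.
move=> YZ; rewrite [Y]res_decl [Z]res_decl; apply: eq_bigr => i _.
rewrite [LHS]res_decr [RHS]res_decr; apply: eq_bigr => j _.
by apply: YZ; rewrite -ltnS.
Qed.

Lemma res_prim_idem i : inj_upto d lam -> (i <= d)%N -> prim_idem X d lam i = e i.
Proof.
move=> injl id; rewrite [LHS]res_decl (bigD1 (inord i)) //= inordK //.
rewrite (eigen_prim_idemE _ _ _ (res_eigl id)) // eqxx big1 ?addr0 // => j ji.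
have jd : (j <= d)%N by rewrite -ltnS.
rewrite (eigen_prim_idemE _ _ _ (res_eigl jd)) //; case: eqP => // E.
by case/eqP: ji; apply/val_inj; rewrite /= inordK.
Qed.

Lemma res_eig_enum :
  inj_upto d lam -> (forall i, (i <= d)%N -> e i != 0) -> eig_enum X d lam.
Proof.
move=> injl e0; split=> // [i id|a].
  have /rowV0Pn[v ve v0] : e i != 0 by apply: e0.
  apply/eigenvalueP; exists v => //; case/submxP: ve => w ->.
  by rewrite -mulmxA res_eigl // scalemxAr.
case/eigenvalueP => v vX v0.
(* The components [v *m e i] sum to [v], so one of them is nonzero; computing [v *m X *m e i] in two
   ways then forces [a = lam i]. *)
have [/existsP[i vi]|/existsPn H] := boolP [exists i : 'I_d.+1, v *m e i != 0].
  have id : (i <= d)%N by rewrite -ltnS.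
  exists i => //; apply/eqP; rewrite -subr_eq0.
  have := congr1 (mulmxr (e i)) vX; rewrite /= -mulmxA res_eigr // -scalemxAl.
  rewrite -scalemxAr => /eqP; rewrite eq_sym -subr_eq0 -scalerBl scaler_eq0.
  by rewrite (negPf vi) orbF.
case/eqP: v0; rewrite [v]res_decr big1 // => i _; apply/eqP.
by have := H i; rewrite negbK.
Qed.

Lemma eigenvalue_res_neq0 i :
  inj_upto d lam -> (i <= d)%N -> eigenvalue X (lam i) -> e i != 0.
Proof.
move=> injl id /eigenvalueP[v vX]; apply: contra => /eqP ei0.
have := eigen_prim_idemE injl id id vX; rewrite eqxx res_prim_idem // ei0 mulmx0.
by move=> <-.
Qed.

Lemma res_diagonalizable : diagonalizable X.
Proof.
apply/diagonalizablePeigen; exists (undup [seq lam i | i <- iota 0 d.+1]).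
  exact: undup_uniq.
apply/eqmxP; rewrite submx1 /= -res_sum; apply/summx_sub => i _.
have li : lam i \in undup [seq lam j | j <- iota 0 d.+1].
  by rewrite mem_undup; apply/map_f; rewrite mem_iota /= add0n ltn_ord.
rewrite (big_rem _ li) /=; apply: submx_trans (addsmxSl _ _).
by apply/eigenspaceP; apply: res_eigl; rewrite -ltnS.
Qed.

Lemma res_eigenspace i : inj_upto d lam -> (i <= d)%N -> (eigenspace X (lam i) :=: e i)%MS.
Proof.
move=> injl id; apply/eqmxP/andP; split; last exact/eigenspaceP/res_eigl.
have /eigenspaceP vX := submx_refl (eigenspace X (lam i)).
have := eigen_prim_idemE injl id id vX; rewrite eqxx res_prim_idem // => <-.
exact: submxMl.
Qed.

End Facts.

Lemma res_conj d (X G Gi : M) lam e :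
  G *m Gi = 1%:M -> Gi *m G = 1%:M -> resolution d X lam e ->
  resolution d (G *m X *m Gi) lam (fun i => G *m e i *m Gi).
Proof.
move=> GGi GiG [el er eo es].
have cM (Y Z : M) : G *m Y *m Gi *m (G *m Z *m Gi) = G *m (Y *m Z) *m Gi.
  by rewrite !mulmxA -[_ *m Gi *m G]mulmxA GiG mulmx1.
split=> [i id|i id|i j id jd|].
- by rewrite cM el // -scalemxAr -scalemxAl.
- by rewrite cM er // -scalemxAr -scalemxAl.
- by rewrite cM eo //; case: ifP; rewrite ?mulmx0 ?mul0mx.
- by rewrite -mulmx_suml -mulmx_sumr es mulmx1.
Qed.

End Resolution.

(** * Intersections of two opposite eigenspace flags *)

Section Flags.
Variables (F : fieldType) (n d : nat).
Local Notation M := 'M[F]_n.+1.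

Definition tridiagonal_on (e : nat -> M) (Y : M) : Prop :=
  forall i j, (i <= d)%N -> (j <= d)%N -> (j.+1 < i)%N || (i.+1 < j)%N ->
    e i *m Y *m e j = 0.

Variables (X Y : M) (xi eta : nat -> F) (e f : nat -> M).
Hypotheses (resX : resolution d X xi e) (resY : resolution d Y eta f).
Hypotheses (triY : tridiagonal_on e Y) (triX : tridiagonal_on f X).

Lemma sub_lowP m (x : 'M_(m, n.+1)) i : (i <= d)%N ->
  (x <= \sum_(j < i.+1) e j)%MS <->
  (forall j, (j <= d)%N -> (i < j)%N -> x *m e j = 0).
Proof.
move=> id; split=> [xL j jd ij|H].
  apply/eqP; rewrite -submx0; apply: submx_trans (submxMr _ xL) _.
  rewrite sumsmxMr; apply/sumsmx_subP => k _.
  by rewrite (res_orth resX) //; have := ltn_ord k; lia.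
rewrite [x](res_decr resX); apply: summx_sub => j _.
have [ij|ji] := ltnP i j; first by rewrite H ?sub0mx // -ltnS.
have ji' : (j < i.+1)%N by [].
by rewrite (sumsmx_sup (Ordinal ji')) // submxMl.
Qed.

Lemma sub_highP m (x : 'M_(m, n.+1)) i :
  (x <= \sum_(i <= j < d.+1) f j)%MS <->
  (forall j, (j <= d)%N -> (j < i)%N -> x *m f j = 0).
Proof.
split=> [xH j jd ji|H].
  apply/sub_kermxP/(submx_trans xH); rewrite big_nat_cond.
  apply: (big_ind (fun S : M => S <= kermx (f j))%MS) => [|S T sS sT|k].
  - exact: sub0mx.
  - by rewrite addsmx_sub sS.
  by move=> ik; apply/sub_kermxP; rewrite (res_orth resY) //; lia.
rewrite [x](res_decr resY); apply: summx_sub => j _.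
have [ij|ji] := leqP i j; last by rewrite H ?sub0mx // -ltnS.
have mj : (j : nat) \in index_iota i d.+1 by rewrite mem_index_iota ij ltn_ord.
by rewrite (big_rem _ mj) /= (submx_trans _ (addsmxSl _ _)) // submxMl.
Qed.

(** With [e = Es], [f = E] and [k = 0] this is the split component [U_i]. The shift [k = 1], with
    [E] and [Es'], gives the invariant subspace used when [c = 0]. Once [i + k > d] the second sum
    is empty. *)
Definition flag_cap k i : M :=
  ((\sum_(j < i.+1) e j) :&: (\sum_(i + k <= j < d.+1) f j))%MS.

Lemma sub_flagP m (x : 'M_(m, n.+1)) k i : (i <= d)%N ->
  (x <= flag_cap k i)%MS <->
  (forall j, (j <= d)%N -> (i < j)%N -> x *m e j = 0) /\
  (forall j, (j <= d)%N -> (j < i + k)%N -> x *m f j = 0).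
Proof.
move=> id; rewrite sub_capmx; split.
  by case/andP => /(sub_lowP _ id) ? /sub_highP ?.
by case=> *; apply/andP; split; [apply/(sub_lowP _ id)|apply/sub_highP].
Qed.

(** The factor [X - xi i] kills the [e i] component and rescales the others, so the top level drops
    by one. *)
Lemma low_subr m (x : 'M_(m, n.+1)) i : (i <= d)%N ->
  (forall j, (j <= d)%N -> (i < j)%N -> x *m e j = 0) ->
  forall j, (j <= d)%N -> (i <= j)%N -> x *m (X - (xi i)%:M) *m e j = 0.
Proof.
move=> id H j jd ij; rewrite -mulmxA mulmxBl (res_eigr resX) // mul_scalar_mx.
rewrite -scalerBl -scalemxAr; case: (ltngtP i j) ij => // [ij|->] _.
  by rewrite H // scaler0.
by rewrite subrr scale0r.
Qed.

Lemma high_subr m (x : 'M_(m, n.+1)) i :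
  (forall j, (j <= d)%N -> (j < i)%N -> x *m f j = 0) ->
  forall j, (j <= d)%N -> (j <= i)%N -> x *m (Y - (eta i)%:M) *m f j = 0.
Proof.
move=> H j jd ji; rewrite -mulmxA mulmxBl (res_eigr resY) // mul_scalar_mx.
rewrite -scalerBl -scalemxAr; case: (ltngtP j i) ji => // [ji|->] _.
  by rewrite H // scaler0.
by rewrite subrr scale0r.
Qed.

(** Tridiagonality lets [Y] climb at most one level of the [e]-flag, and a scalar does not climb at
    all. *)
Lemma low_mulr m (x : 'M_(m, n.+1)) i (a : F) :
  (forall j, (j <= d)%N -> (i < j)%N -> x *m e j = 0) ->
  forall j, (j <= d)%N -> (i.+1 < j)%N -> x *m (Y - a%:M) *m e j = 0.
Proof.
move=> H j jd ij; rewrite mulmxBr mulmxBl mul_mx_scalar -scalemxAl.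
rewrite (H j) ?scaler0 ?subr0 //; last by lia.
rewrite [x](res_decr resX) !mulmx_suml big1 // => k _.
have kd : (k <= d)%N by rewrite -ltnS.
have [ik|ki] := ltnP i k; first by rewrite H // !mul0mx.
by rewrite -!mulmxA [e k *m _]mulmxA triY ?mulmx0 //; lia.
Qed.

Lemma high_mulr m (x : 'M_(m, n.+1)) i (a : F) :
  (forall j, (j <= d)%N -> (j < i)%N -> x *m f j = 0) ->
  forall j, (j <= d)%N -> (j.+1 < i)%N -> x *m (X - a%:M) *m f j = 0.
Proof.
move=> H j jd ij; rewrite mulmxBr mulmxBl mul_mx_scalar -scalemxAl.
rewrite (H j) ?scaler0 ?subr0 //; last by lia.
rewrite [x](res_decr resY) !mulmx_suml big1 // => k _.
have kd : (k <= d)%N by rewrite -ltnS.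
have [ki|ik] := ltnP k i; first by rewrite H // !mul0mx.
by rewrite -!mulmxA [f k *m _]mulmxA triX ?mulmx0 //; lia.
Qed.

Lemma flag_cap_down0 k : flag_cap k 0 *m (X - (xi 0)%:M) = 0.
Proof.
have [H1 _] := (sub_flagP _ k (leq0n d)).1 (submx_refl _).
rewrite [LHS](res_decr resX) big1 // => j _.
by apply: low_subr => //; rewrite -ltnS.
Qed.

(** The shifted [X] removes the top [e]-level, while tridiagonality on [f] costs at most one
    [f]-level at the bottom; both bounds then fit index [i]. *)
Lemma flag_cap_down k i : (i < d)%N ->
  (flag_cap k i.+1 *m (X - (xi i.+1)%:M) <= flag_cap k i)%MS.
Proof.
move=> id; have [H1 H2] := (sub_flagP _ k id).1 (submx_refl _).
apply/sub_flagP; first exact: ltnW; split=> [j jd ij|j jd ji].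
  exact: low_subr.
by apply: (high_mulr _ H2) => //; rewrite addSn.
Qed.

Lemma flag_cap_up k i : (i < d)%N ->
  (flag_cap k i *m (Y - (eta (i + k))%:M) <= flag_cap k i.+1)%MS.
Proof.
move=> id; have [H1 H2] := (sub_flagP _ k (ltnW id)).1 (submx_refl _).
apply/sub_flagP => //; split=> [j jd ij|j jd ji].
  exact: (low_mulr _ H1).
by apply: high_subr => //; rewrite addSn in ji.
Qed.

(** For [k = 0] the rows lie in the eigenspace of [eta d]; for [k > 0] the intersection is 0, so the
    out-of-range value [eta (d + k)] is harmless. *)
Lemma flag_cap_upd k : flag_cap k d *m (Y - (eta (d + k))%:M) = 0.
Proof.
have [_ H2] := (sub_flagP _ k (leqnn d)).1 (submx_refl _).
rewrite [LHS](res_decr resY) big1 // => j _.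
have jd : (j <= d)%N by rewrite -ltnS.
by apply: high_subr => //; lia.
Qed.

Definition flag_sum k : M := (\sum_(i < d.+1) flag_cap k i)%MS.

Lemma flag_sum_stable k :
  (flag_sum k *m X <= flag_sum k)%MS /\ (flag_sum k *m Y <= flag_sum k)%MS.
Proof.
have sub i : (i <= d)%N -> (flag_cap k i <= flag_sum k)%MS.
  by move=> id; rewrite (sumsmx_sup (Ordinal (id : i < d.+1)%N)).
(* Undoing the scalar shift only adds a multiple of [S], so it suffices to follow the shifted
   maps. *)
have shift (S Z : M) (a : F) : (S <= flag_sum k)%MS ->
    (S *m (Z - a%:M) <= flag_sum k)%MS -> (S *m Z <= flag_sum k)%MS.
  move=> S1 S2; rewrite -[Z](subrK a%:M) mulmxDr addmx_sub //.
  by rewrite mul_mx_scalar scalemx_sub.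
split; rewrite {1}/flag_sum sumsmxMr; apply/sumsmx_subP => -[i id] _ /=.
  apply: (shift _ _ (xi i)); first exact: sub.
  case: i id => [|i] id; first by rewrite flag_cap_down0 sub0mx.
  by apply: submx_trans (flag_cap_down k _) (sub _ _) => //; apply: ltnW.
apply: (shift _ _ (eta (i + k))); first exact: sub.
move: id; rewrite ltnS leq_eqVlt => /predU1P[->|id].
  by rewrite flag_cap_upd sub0mx.
exact: submx_trans (flag_cap_up k id) (sub _ _).
Qed.

End Flags.

(** * Tridiagonal systems as resolutions, and the q-Serre relations *)

Section Tridiagonal.
Variables (F : fieldType) (n d : nat).
Local Notation M := 'M[F]_n.+1.

Lemma TDsystem_resolution (A As : M) E Es th ths :
  TDsystem d A E As Es -> eig_seq d A E th -> eig_seq d As Es ths ->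
  [/\ resolution d A th E, resolution d As ths Es,
      inj_upto d th /\ inj_upto d ths,
      tridiagonal_on d E As /\ tridiagonal_on d Es A
    & forall i, (i <= d)%N -> E i != 0 /\ Es i != 0].
Proof.
have main (X : M) (e : nat -> M) lam : diagonalizable X -> idem_ordering X d e ->
    eig_seq d X e lam -> [/\ resolution d X lam e, inj_upto d lam
      & forall i, (i <= d)%N -> e i != 0].
  move=> dX [mu en eE] eX; have [inj eig _] := en.
  have res := diagonalizable_resolution dX en.
  have e0 i : (i <= d)%N -> e i != 0.
    by move=> id; rewrite eE // (eigenvalue_res_neq0 res) //; apply: eig.
  (* The ordering carries its own eigenvalue list [mu]; as [e i] is nonzero, it has only one
     eigenvalue, so the two lists agree. *)
  have lamE i : (i <= d)%N -> lam i = mu i.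
    move=> id; have := eX i id; rewrite {1}eE // (res_eigl res) // -eE // => /eqP.
    by rewrite -subr_eq0 -scalerBl scaler_eq0 subr_eq0 (negPf (e0 i id)) orbF => /eqP.
  split=> //; last by move=> i j id jd; rewrite !lamE //; apply: inj.
  case: res => el er eo es; split=> [i id|i id|i j id jd|].
  - by rewrite lamE // eE // el.
  - by rewrite lamE // eE // er.
  - by rewrite !eE // eo.
  - by rewrite -es; apply: eq_bigr => i _; rewrite eE // -ltnS.
case=> -[dA dAs] iE iEs tri _ eA eAs.
have [rA injA A0] := main _ _ _ dA iE eA.
have [rAs injAs As0] := main _ _ _ dAs iEs eAs.
split=> // [|i id]; last by rewrite A0 // As0.
by split=> i j id jd ij; have [] := tri i j id jd ij.
Qed.

Lemma res_idem_ordering (X : M) lam e :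
  resolution d X lam e -> inj_upto d lam -> (forall i, (i <= d)%N -> e i != 0) ->
  idem_ordering X d e.
Proof.
move=> res inj e0; exists lam; first exact: res_eig_enum res inj e0.
by move=> i id; rewrite (res_prim_idem res).
Qed.

Lemma res_tridiag_ordering (X Y : M) lam e :
  resolution d X lam e -> inj_upto d lam -> (forall i, (i <= d)%N -> e i != 0) ->
  tridiagonal_on d e Y -> tridiag_ordering X Y d lam.
Proof.
move=> res inj e0 tri; split=> [|i id]; first exact: res_eig_enum res inj e0.
have sub j : (j <= d)%N -> (e j <= esp X d lam j)%MS.
  by move=> jd; rewrite /esp jd (res_eigenspace res).
apply: (@submx_trans _ _ _ _ _ _ (e i *m Y)).
  by rewrite submxMr // /esp id (res_eigenspace res).
rewrite [X in (X <= _)%MS](res_decr res); apply: summx_sub => -[j jd] _ /=.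
rewrite ltnS in jd.
have [ij|] := boolP ((j.+1 < i)%N || (i.+1 < j)%N); first by rewrite tri ?sub0mx.
move=> ij; apply: submx_trans (submxMl _ _) _; apply: submx_trans (sub j jd) _.
have : [|| j == i, j == i.+1 | i == j.+1] by lia.
case/or3P => /eqP E; last 1 first.
- by rewrite E /= (submx_trans _ (addsmxSl _ _)) // addsmxSl.
- by rewrite E (submx_trans _ (addsmxSl _ _)) // addsmxSr.
- by rewrite E addsmxSr.
Qed.

Lemma TDsystem_TDpair (A As : M) E Es : TDsystem d A E As Es -> TDpair A As.
Proof.
move=> Phi; have [[dA dAs] [th enA EE] [ths enAs EsE] tri irr] := Phi.
have eigA : eig_seq d A E th.
  by move=> i id; rewrite EE // (res_eigl (diagonalizable_resolution dA enA)).
have eigAs : eig_seq d As Es ths.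
  by move=> i id; rewrite EsE // (res_eigl (diagonalizable_resolution dAs enAs)).
have [rA rAs [iA iAs] [tA tAs] n0] := TDsystem_resolution Phi eigA eigAs.
split=> //; [exists d, th|exists d, ths].
  by apply: (res_tridiag_ordering rA) => // i /n0[].
by apply: (res_tridiag_ordering rAs) => // i /n0[].
Qed.

(* Sandwiched between e_i and e_j, the cubic expression becomes
   (lam_j - lam_i) (lam_j - r lam_i) (lam_j - r^-1 lam_i) e_i Y e_j. *)
Lemma tridiagonal_cubic (X Y : M) lam e (r c : F) :
  resolution d X lam e -> tridiagonal_on d e Y ->
  r != 0 -> c = r + 1 + r^-1 -> (forall i, lam i.+1 = r * lam i) ->
  Y *m X *m X *m X - c *: (X *m Y *m X *m X)
    + c *: (X *m X *m Y *m X) - X *m X *m X *m Y = 0.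
Proof.
move=> res tri r0 cE lamS; apply: (res_ext res) => i j id jd; rewrite mulmx0 mul0mx.
pose z := e i *m Y *m e j.
have -> : e i *m (Y *m X *m X *m X - c *: (X *m Y *m X *m X)
    + c *: (X *m X *m Y *m X) - X *m X *m X *m Y) *m e j =
  (lam j ^+ 3 - c * lam i * lam j ^+ 2 + c * lam i ^+ 2 * lam j - lam i ^+ 3) *: z.
  rewrite !(mulmxDr, mulmxDl, mulmxN, mulNmx) -!scalemxAr -!scalemxAl.
  have eR (Z : M) : e i *m (Z *m X) *m e j = lam j *: (e i *m Z *m e j).
    by rewrite -!mulmxA (res_eigr res) // !mulmxA -!scalemxAr.
  have eL (Z : M) : e i *m (X *m Z) *m e j = lam i *: (e i *m Z *m e j).
    by rewrite !mulmxA (res_eigl res) // -!scalemxAl.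
  rewrite !eR -!(mulmxA X) !eL -/z !scalerA -scalerBl -scalerDl -scalerBl.
  by congr (_ *: _); ring.
have [ij|] := boolP ((j.+1 < i)%N || (i.+1 < j)%N).
  by rewrite /z tri // scaler0.
(* The cases [j = i], [j = i.+1] and [i = j.+1] annihilate the three factors in turn. *)
move=> ij; have : [|| j == i, j == i.+1 | i == j.+1] by lia.
by case/or3P => /eqP E; rewrite E ?lamS cE -[RHS](scale0r z); congr (_ *: _); field.
Qed.

Lemma qint3E (q : F) : q != 0 -> q ^+ 2 != 1 -> qint q 3 = q ^+ 2 + 1 + q ^- 2.
Proof.
move=> q0 q1; rewrite /qint; field; rewrite q0 /=.
by rewrite subr_eq0 -expr2.
Qed.

(** The coefficient [r + 1 + r^-1] is invariant under inverting [r], so [[3]_q] serves both the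
    ratio [q ^+ 2] of [th] and the ratio [q ^- 2] of [ths]. *)
Lemma tridiagonal_qSerre (q : F) (A As : M) th ths E Es :
  q != 0 -> q ^+ 2 != 1 ->
  (forall i, th i.+1 = q ^+ 2 * th i) -> (forall i, ths i.+1 = q ^- 2 * ths i) ->
  resolution d A th E -> resolution d As ths Es ->
  tridiagonal_on d E As -> tridiagonal_on d Es A -> qSerre q A As.
Proof.
move=> q0 q1 thS thsS rA rAs tA tAs; split.
  by apply: (tridiagonal_cubic rA tA _ _ thS); rewrite ?qint3E ?expf_neq0.
apply: (tridiagonal_cubic rAs tAs _ _ thsS); rewrite ?invr_eq0 ?expf_neq0 //.
by rewrite qint3E // invrK; ring.
Qed.

(** Sandwiching the relation gives [(q^-1 lam_j - q lam_i) e_i Z e_j = 0] for [i != j], so a nonzero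
    off-diagonal block requires [lam_j = q^2 lam_i]. *)
Lemma qWeyl_tridiagonal (q c : F) (X Z : M) lam e :
  q != 0 -> resolution d X lam e ->
  q^-1 *: (Z *m X) - q *: (X *m Z) = c%:M ->
  (forall i j, (i <= d)%N -> (j <= d)%N -> (j.+1 < i)%N || (i.+1 < j)%N ->
    lam j != q ^+ 2 * lam i) ->
  tridiagonal_on d e Z.
Proof.
move=> q0 res rel lamN i j id jd ij.
have := congr1 (fun T => e i *m T *m e j) rel.
rewrite mulmxBr mulmxBl -!scalemxAr -!scalemxAl -!mulmxA (res_eigr res) //.
rewrite [e i *m (X *m _)]mulmxA (res_eigl res) // mul_scalar_mx -!scalemxAr.
rewrite -scalemxAl (res_orth res) //; last by lia.
rewrite scaler0 !scalerA -scalerBl => /eqP; rewrite scaler_eq0 subr_eq0 mulmxA.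
case/orP => [/eqP E|/eqP //]; case/eqP: (lamN i j id jd ij).
by rewrite expr2 -mulrA -E mulrA mulfV // mul1r.
Qed.

End Tridiagonal.

(** The right side is the Lagrange polynomial equal to 1 at [th 0] and 0 at the later nodes; the
    left side is its Newton form. Induction adds one node at a time. *)
Lemma newton_delta (F : fieldType) (th : nat -> F) (x : F) m :
  (forall k, (0 < k)%N -> (k <= m)%N -> th 0%N != th k) ->
  \sum_(i < m.+1) (\prod_(1 <= k < i.+1) (th 0%N - th k))^-1
                  * \prod_(0 <= k < i) (x - th k)
  = \prod_(1 <= k < m.+1) ((x - th k) / (th 0%N - th k)).
Proof.
elim: m => [|m IH] thN.
  by rewrite big_ord_recl big_ord0 addr0 !big_geq // invr1 mulr1.
rewrite big_ord_recr /= {}IH => [|k k0 km]; last by rewrite thN // leqW.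
rewrite [RHS]big_nat_recr //= [X in (X)^-1]big_nat_recr //=.
rewrite [X in _ + _ * X]big_ltn // prodf_div.
set N := \prod_(1 <= k < _) (x - th k); set P := \prod_(1 <= k < _) (th 0%N - th k).
have P0 : P != 0.
  rewrite prodf_seq_neq0; apply/allP => k; rewrite mem_index_iota => /andP[k0 km].
  by rewrite subr_eq0 thN // ltnW.
have tm : th 0%N - th m.+1 != 0 by rewrite subr_eq0 thN.
by field; rewrite tm.
Qed.

(** * Graded hull and graded part of an invariant subspace *)

Section Graded.
Variables (F : fieldType) (n d : nat).
Local Notation M := 'M[F]_n.+1.
Variables (Z : M) (z : nat -> F) (p : nat -> M).
Hypothesis rp : resolution d Z z p.

Definition graded_hull (W : M) : M := (\sum_(i < d.+1) W *m p i)%MS.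
Definition graded_part (W : M) : M := (\sum_(i < d.+1) (W :&: p i))%MS.

Lemma sub_graded_hull W : (W <= graded_hull W)%MS.
Proof.
rewrite {1}[W](res_decr rp); apply: summx_sub => i _.
by rewrite (sumsmx_sup i).
Qed.

Lemma graded_part_sub W : (graded_part W <= W)%MS.
Proof. by apply/sumsmx_subP => i _; rewrite capmxSl. Qed.

Variables (X Y : M) (x y : nat -> F) (s : F) (link : rel nat).
Hypothesis s0 : s != 0.
Hypotheses (linkl : forall i j k, link i j -> link k j -> k = i).
Hypotheses (linkr : forall i j k, link i j -> link i k -> k = j).
Hypothesis offX : forall i j, (i <= d)%N -> (j <= d)%N -> ~~ link i j ->
  p i *m X *m p j = x i *: (p i *m p j).
Hypothesis offY : forall i j, (i <= d)%N -> (j <= d)%N -> ~~ link i j ->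
  p i *m Y *m p j = y i *: (p i *m p j).
Hypothesis onXY : forall i j, (i <= d)%N -> (j <= d)%N -> link i j ->
  p i *m X *m p j = s *: (p i *m Y *m p j).

(** [X] and [Y] have scalar blocks except at linked positions, where they differ by the factor [s].
    Later this transfers stability from [Bs] to [As] (lowering links, [s = t]), and from [A] to
    itself (raising links, [s = 1]). *)
Lemma graded_hull_stable W : (W *m X <= W)%MS ->
  (graded_hull W *m Y <= graded_hull W)%MS.
Proof.
move=> WX; rewrite {1}/graded_hull sumsmxMr; apply/sumsmx_subP => i _.
have subp k : (k <= d)%N -> (W *m p k <= graded_hull W)%MS.
  by move=> kd; rewrite (sumsmx_sup (Ordinal (kd : k < d.+1)%N)).
have subpp k j (c : F) : (k <= d)%N -> (j <= d)%N ->
    (W *m (c *: (p k *m p j)) <= graded_hull W)%MS.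
  move=> kd jd; rewrite -scalemxAr scalemx_sub //.
  have [->|kj] := eqVneq k j; first by rewrite (res_idem rp) // subp.
  by rewrite (res_orth rp) // mulmx0 sub0mx.
rewrite [X in (X <= _)%MS](res_decr rp); apply: summx_sub => j _.
have [id jd] := (leq_ord i, leq_ord j); rewrite -!(mulmxA W).
have [lij|nlij] := boolP (link i j); last by rewrite offY // subpp.
have -> : p i *m Y *m p j = s^-1 *: (p i *m X *m p j).
  by rewrite onXY // scalerA mulVf // scale1r.
rewrite -scalemxAr scalemx_sub //.
(* Only [i] is linked to [j], so the other blocks ending at [j] send [W] into multiples of
   [W *m p j], and the linked block can be isolated. *)
have -> : W *m (p i *m X *m p j) = W *m X *m p j
    - \sum_(k < d.+1 | k != i) W *m (p k *m X *m p j).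
  apply/eqP; rewrite eq_sym subr_eq; apply/eqP.
  rewrite -(mulmxA W) {1}[X *m p j](res_decl rp) mulmx_sumr (bigD1 i) //=.
  by congr (_ + _); rewrite ?mulmxA //; apply: eq_bigr => k _; rewrite !mulmxA.
rewrite addmx_sub //; first by apply: submx_trans (submxMr _ WX) (subp _ jd).
rewrite eqmx_opp; apply: summx_sub => k ki; rewrite offX ?subpp ?leq_ord //.
by apply: contra ki => /(linkl lij) /val_inj ->.
Qed.

(** Dual to the hull: [i] is linked to at most one [j], so subtracting from [T *m X] its components
    outside [j], all in [T], leaves the linked component inside [W]. *)
Lemma graded_part_stable W : (W *m X <= W)%MS ->
  (graded_part W *m Y <= graded_part W)%MS.
Proof.
move=> WX; rewrite {1}/graded_part sumsmxMr; apply/sumsmx_subP => i _.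
have id := leq_ord i; set T := (W :&: p i)%MS.
have TW : (T <= W)%MS by rewrite capmxSl.
have Tp : T = T *m p i.
  have /submxP[D ->] : (T <= p i)%MS by rewrite capmxSr.
  by rewrite -mulmxA (res_idem rp).
have Tpp j : (j <= d)%N -> (T *m p j <= T)%MS.
  move=> jd; rewrite Tp -mulmxA; have [<-|ij] := eqVneq (i : nat) j.
    by rewrite (res_idem rp).
  by rewrite (res_orth rp) // mulmx0 sub0mx.
have ToffX k : (k <= d)%N -> ~~ link i k -> (T *m X *m p k <= T)%MS.
  move=> kd nl; rewrite {1}Tp -!(mulmxA T) offX // -scalemxAr scalemx_sub //.
  by rewrite mulmxA -Tp Tpp.
rewrite [X in (X <= _)%MS](res_decr rp); apply: summx_sub => j _.
have jd := leq_ord j.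
have [lij|nlij] := boolP (link i j); last first.
  rewrite {1}Tp -!(mulmxA T) offY // -scalemxAr scalemx_sub // mulmxA -Tp.
  by rewrite (sumsmx_sup i) // Tpp.
have -> : T *m Y *m p j = s^-1 *: (T *m X *m p j).
  by rewrite Tp -!(mulmxA T) onXY // -scalemxAr scalerA mulVf // scale1r.
rewrite scalemx_sub // (sumsmx_sup j) // sub_capmx submxMl andbT.
have -> : T *m X *m p j = T *m X - \sum_(k < d.+1 | k != j) T *m X *m p k.
  by apply/eqP; rewrite eq_sym subr_eq {1}[T *m X](res_decr rp) (bigD1 j).
rewrite addmx_sub //; first exact: submx_trans (submxMr _ TW) WX.
rewrite eqmx_opp; apply: summx_sub => k kj; apply: submx_trans TW.
rewrite ToffX ?leq_ord //; apply: contra kj.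
by move/(linkr lij)/val_inj ->.
Qed.

End Graded.

(** * The split grading and the block form of [A] and [As] *)

Section Perturbation.
Variables (F : fieldType) (n d : nat) (q : F).
Local Notation M := 'M[F]_n.+1.
Variables (A As Km : M) (E Es : nat -> M) (th ths : nat -> F).
Hypotheses (q0 : q != 0) (q1 : q ^+ 2 != 1) (d0 : (0 < d)%N).
Hypotheses (rA : resolution d A th E) (rAs : resolution d As ths Es).
Hypotheses (inj_th : inj_upto d th) (inj_ths : inj_upto d ths).
Hypotheses (tA : tridiagonal_on d E As) (tAs : tridiagonal_on d Es A).
Hypotheses (E0 : forall i, (i <= d)%N -> E i != 0).
Hypotheses (Es0 : forall i, (i <= d)%N -> Es i != 0).
Hypothesis irr : irred_pair A As.
Hypotheses (thS : forall i, th i.+1 = q ^+ 2 * th i).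
Hypotheses (thsS : forall i, ths i.+1 = q ^- 2 * ths i).
Hypothesis th_ths : forall i, th i * ths i = 1.
Hypothesis th_nadj : forall i j, (i <= d)%N -> (j <= d)%N ->
  (j.+1 < i)%N || (i.+1 < j)%N -> th j != q ^+ 2 * th i.
Hypothesis ths_nadj : forall i j, (i <= d)%N -> (j <= d)%N ->
  (j.+1 < i)%N || (i.+1 < j)%N -> ths j != q ^+ 2 * ths i.

Local Notation U i := (splitU d E Es i).
Hypothesis hK : forall i, (i <= d)%N -> U i *m Km = ths i *: U i.

Lemma splitUE i : U i = flag_cap d Es E 0 i.
Proof. by rewrite /flag_cap addn0. Qed.

(** The sum is invariant under [A] and [As] and contains the nonzero [Es 0], so irreducibility makes
    it everything. *)
Lemma splitU_span : (1%:M <= \sum_(i < d.+1) U i)%MS.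
Proof.
rewrite (eq_bigr (fun i : 'I_d.+1 => flag_cap d Es E 0 i)) => [|i _]; last exact: splitUE.
have [sAs sA] := flag_sum_stable rAs rA tAs tA 0.
case: (irr sA sAs) => /andP[S0 S1] //.
have : (Es 0%N <= flag_sum d Es E 0)%MS.
  apply: (sumsmx_sup ord0) => //; apply/(sub_flagP rAs rA) => //=; split=> // j jd j0.
  by rewrite (res_orth rAs) //; case: j j0 {jd}.
by move/submx_trans/(_ S0); rewrite submx0 (negPf (Es0 _)).
Qed.

(** Since [Km] acts on [U_i] as [ths i], the projections along the split decomposition are its
    primitive idempotents. *)
Definition gproj : nat -> M := prim_idem Km d ths.
Local Notation p := gproj.

Lemma gproj_res : resolution d Km ths p.
Proof. exact: resolution_of_span inj_ths hK splitU_span. Qed.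
Local Notation rK := gproj_res.

Lemma gprojE i : (i <= d)%N -> (p i :=: U i)%MS.
Proof.
move=> id; have Up j : (j <= d)%N -> U j *m p i = if j == i then U j else 0.
  by move=> jd; apply: (eigen_prim_idemE inj_ths id jd (hK jd)).
apply/eqmxP/andP; split; last by rewrite -[U i](_ : U i *m p i = _) ?submxMl // Up // eqxx.
rewrite -[p i]mul1mx; apply: submx_trans (submxMr _ splitU_span) _.
rewrite sumsmxMr; apply/sumsmx_subP => -[j jd] _ /=; rewrite Up //.
by case: eqP => [->|_]; rewrite ?sub0mx.
Qed.

Lemma gproj_E i j : (i <= d)%N -> (j < i)%N -> p i *m E j = 0.
Proof.
move=> id ji; have : (p i <= flag_cap d Es E 0 i)%MS by rewrite -splitUE gprojE.
by case/(sub_flagP rAs rA _ _ id) => _ H; apply: H; rewrite ?addn0 //; lia.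
Qed.

Lemma gproj_Es i j : (j <= d)%N -> (i < j)%N -> p i *m Es j = 0.
Proof.
move=> jd ij; have id : (i <= d)%N by lia.
have : (p i <= flag_cap d Es E 0 i)%MS by rewrite -splitUE gprojE.
by case/(sub_flagP rAs rA _ _ id) => H _; apply: H.
Qed.

(** Together with [Es0_gproj0]: [p 0] and [Es 0] project onto the same space [U_0], in general along
    different complements. *)
Lemma gproj0_Es0 : p 0 *m Es 0%N = p 0.
Proof.
rewrite [RHS](res_decr rAs) big_ord_recl big1 ?addr0 // => i _.
by rewrite gproj_Es // lift0 ltn_ord.
Qed.

Lemma Es0_gproj0 : Es 0%N *m p 0 = Es 0%N.
Proof.
have : (Es 0%N <= p 0)%MS.
  rewrite gprojE // splitUE; apply/(sub_flagP rAs rA) => //; split=> // j jd j0.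
  by rewrite (res_orth rAs) //; case: j j0 {jd}.
by case/submxP => D ->; rewrite -mulmxA (res_idem rK).
Qed.

(** For [i > 0] the space [U_i] has no [E 0] component, so [E 0] factors through [p 0]. *)
Lemma gproj0_E0 : p 0 *m E 0%N = E 0%N.
Proof.
rewrite [RHS](res_decl rK) big_ord_recl [X in _ = _ + X]big1 ?addr0 // => i _.
by rewrite gproj_E // lift0 ltn_ord.
Qed.

Lemma gproj0_neq0 : p 0 != 0.
Proof.
by have := Es0 (leq0n d); apply: contraNneq => p00; rewrite -Es0_gproj0 p00 mulmx0.
Qed.

Lemma Ed_sub_gproj : (E d <= p d)%MS.
Proof.
rewrite gprojE // splitUE; apply/(sub_flagP rAs rA) => //; split=> j jd; first by lia.
by rewrite addn0 => jd'; rewrite (res_orth rA) //; lia.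
Qed.

(** Block form of [A = K^-1 + R]: apart from the diagonal, only the raising block from [i] to [i.+1]
    survives. *)
Lemma gproj_A i j : (i <= d)%N -> (j <= d)%N -> j != i.+1 ->
  p i *m A *m p j = th i *: (p i *m p j).
Proof.
move=> id jd ji; apply/eqP; rewrite -subr_eq0 -mul_scalar_mx mulmxA -mulmxBl.
rewrite -scalar_mxC -mulmxBr; apply/eqP.
have /submxP[D UD] : (p i <= U i)%MS by rewrite gprojE.
have [di|di] := eqVneq i d.
  have := flag_cap_upd rAs rA 0; rewrite addn0 -splitUE => U0.
  by rewrite UD di -(mulmxA D) U0 mulmx0 mul0mx.
have id' : (i < d)%N by rewrite ltn_neqAle di.
have sub : (p i *m (A - (th i)%:M) <= p i.+1)%MS.
  rewrite gprojE // UD -mulmxA; apply: submx_trans (submxMl _ _) _.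
  by have := flag_cap_up rAs rA tAs 0 id'; rewrite -!splitUE addn0.
by case/submxP: sub => T ->; rewrite -mulmxA (res_orth rK) ?mulmx0 // eq_sym.
Qed.

Lemma gproj_As i j : (i <= d)%N -> (j <= d)%N -> i != j.+1 ->
  p i *m As *m p j = ths i *: (p i *m p j).
Proof.
move=> id jd ij; apply/eqP; rewrite -subr_eq0 -mul_scalar_mx mulmxA -mulmxBl.
rewrite -scalar_mxC -mulmxBr; apply/eqP.
have /submxP[D UD] : (p i <= U i)%MS by rewrite gprojE.
case: i => [|i] in id ij D UD *.
  by rewrite UD -(mulmxA D) splitUE (flag_cap_down0 rAs rA) mulmx0 mul0mx.
have sub : (p i.+1 *m (As - (ths i.+1)%:M) <= p i)%MS.
  rewrite (gprojE (ltnW id)) UD -mulmxA; apply: submx_trans (submxMl _ _) _.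
  by have := flag_cap_down rAs rA tA 0 id; rewrite -!splitUE.
by case/submxP: sub => T ->; rewrite -mulmxA (res_orth rK (ltnW id)) ?mulmx0.
Qed.

Definition gdiag (c : nat -> F) : M := \sum_(i < d.+1) c i *: p i.

Lemma gproj_gdiag c i : (i <= d)%N -> p i *m gdiag c = c i *: p i.
Proof.
move=> id; rewrite mulmx_sumr (bigD1 (inord i)) //= inordK // -scalemxAr (res_idem rK) //.
rewrite big1 ?addr0 // => j ji; rewrite -scalemxAr (res_orth rK) ?scaler0 ?leq_ord //.
by apply: contra ji => /eqP ->; rewrite inord_val.
Qed.

Lemma gdiag_gproj c i : (i <= d)%N -> gdiag c *m p i = c i *: p i.
Proof.
move=> id; rewrite mulmx_suml (bigD1 (inord i)) //= inordK // -scalemxAl (res_idem rK) //.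
rewrite big1 ?addr0 // => j ji; rewrite -scalemxAl (res_orth rK) ?scaler0 ?leq_ord //.
by apply: contra ji => /eqP <-; rewrite inord_val.
Qed.

Lemma gdiagV c : (forall i, c i != 0) -> gdiag c *m gdiag (fun i => (c i)^-1) = 1%:M.
Proof.
move=> c0; apply: (res_ext rK) => i j id jd; rewrite mulmx1 mulmxA gproj_gdiag //.
rewrite -!scalemxAl -mulmxA gdiag_gproj // -scalemxAr scalerA.
have [->|ij] := eqVneq i j; first by rewrite mulfV ?scale1r.
by rewrite (res_orth rK) // scaler0.
Qed.

(** * The q-Weyl relations; by [th_ths], [Ki] is the inverse of [Km] *)

Local Notation Ki := (gdiag th).

(** On diagonal blocks [th i * ths i = 1] produces the scalar; on raising blocks the coefficient
    [q^-1 ths_i - q ths_(i+1)] vanishes. *)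
Lemma qWeyl_K_A : q^-1 *: (Km *m A) - q *: (A *m Km) = (q^-1 - q)%:M.
Proof.
apply: (res_ext rK) => i j id jd.
rewrite mulmxBr mulmxBl -!scalemxAr -!scalemxAl !mulmxA (res_eigl rK) // -!scalemxAl.
rewrite -[_ *m Km *m p j]mulmxA (res_eigr rK) // -scalemxAr mul_mx_scalar -scalemxAl.
rewrite !scalerA -scalerBl; have [jE|ji] := eqVneq j i.+1.
  rewrite {}jE in jd *; rewrite thsS (res_orth rK) //; last by lia.
  rewrite scaler0 -[RHS](scale0r (p i *m A *m p i.+1)); congr (_ *: _).
  by field.
rewrite gproj_A // scalerA; have [->|ij] := eqVneq i j; last first.
  by rewrite (res_orth rK) // !scaler0.
by rewrite -mulrBl -mulrA [ths j * _]mulrC th_ths mulr1.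
Qed.

Lemma qWeyl_Ki_As : q^-1 *: (Ki *m As) - q *: (As *m Ki) = (q^-1 - q)%:M.
Proof.
apply: (res_ext rK) => i j id jd.
rewrite mulmxBr mulmxBl -!scalemxAr -!scalemxAl !mulmxA gproj_gdiag // -!scalemxAl.
rewrite -[_ *m Ki *m p j]mulmxA gdiag_gproj // -scalemxAr mul_mx_scalar -scalemxAl.
rewrite !scalerA -scalerBl; have [iE|ji] := eqVneq i j.+1.
  rewrite {}iE in id *; rewrite thS (res_orth rK) //; last by lia.
  rewrite scaler0 -[RHS](scale0r (p j.+1 *m As *m p j)); congr (_ *: _).
  by field.
rewrite gproj_As // scalerA; have [->|ij] := eqVneq i j; last first.
  by rewrite (res_orth rK) // !scaler0.
by rewrite -mulrBl -mulrA th_ths mulr1.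
Qed.

Lemma tridiagonal_K : tridiagonal_on d E Km.
Proof. exact: qWeyl_tridiagonal q0 rA qWeyl_K_A th_nadj. Qed.

Lemma tridiagonal_Ki : tridiagonal_on d Es Ki.
Proof. exact: qWeyl_tridiagonal q0 rAs qWeyl_Ki_As ths_nadj. Qed.

(** * Newton polynomials in [A] *)

Definition tau i : M := \prod_(j < i) (A - (th j)%:M).

(** Each factor [A - th j] cancels the diagonal block on [U_j], so only raising remains and [tau i]
    maps [U_0] into [U_i]. *)
Lemma gproj0_tau i : (i <= d)%N -> p 0 *m tau i *m p i = p 0 *m tau i.
Proof.
elim: i => [|i IH] id; first by rewrite /tau big_ord0 mulmx1 (res_idem rK).
rewrite /tau big_ord_recr /= -mulmxE mulmxA -/(tau i) -IH 1?ltnW // -!mulmxA.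
congr (_ *m (_ *m _)).
rewrite [RHS](res_decr rK) (bigD1 (inord i.+1)) //= inordK // big1 ?addr0 ?mulmxA // => j ji.
have jd : (j <= d)%N by rewrite -ltnS.
have {}ji : (j : nat) != i.+1 by apply: contra ji => /eqP <-; rewrite inord_val.
by rewrite mulmxBr mulmxBl mul_mx_scalar gproj_A // 1?ltnW // -scalemxAl subrr.
Qed.

Lemma newton_prim_idem0 :
  E 0%N = \sum_(i < d.+1) (\prod_(1 <= j < i.+1) (th 0%N - th j))^-1 *: tau i.
Proof.
rewrite [RHS](res_decl rA) [LHS](res_decl rA); apply: eq_bigr => j _.
have jd := leq_ord j.
have etau i : E j *m tau i = (\prod_(0 <= k < i) (th j - th k)) *: E j.
  elim: i => [|i IH]; first by rewrite /tau big_ord0 big_geq // scale1r mulmx1.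
  rewrite /tau big_ord_recr /= -mulmxE mulmxA IH -scalemxAl mulmxBr (res_eigl rA) //.
  by rewrite mul_mx_scalar -scalerBl scalerA big_nat_recr.
rewrite mulmx_sumr (eq_bigr (fun i : 'I_d.+1 =>
  ((\prod_(1 <= k < i.+1) (th 0%N - th k))^-1 * \prod_(0 <= k < i) (th j - th k)) *: E j));
  last by move=> i _; rewrite -scalemxAr etau scalerA.
rewrite -scaler_suml newton_delta; last first.
  by move=> k k0 kd; apply/eqP => /inj_th -/(_ isT kd) kE; rewrite -kE in k0.
have [j0|j0] := posnP j.
  rewrite j0 big_nat big1 ?scale1r ?(res_idem rA) // => k /andP[k0 kd].
  by rewrite divff // subr_eq0; apply/eqP => /inj_th -/(_ isT kd) kE; rewrite -kE in k0.
rewrite (res_orth rA) //; last by rewrite -lt0n.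
have mj : (j : nat) \in index_iota 1 d.+1 by rewrite mem_index_iota j0 ltn_ord.
by rewrite (big_rem _ mj) /= subrr !mul0r scale0r.
Qed.

(** * Conjugation by [G] for nonzero [t] *)

Section Scaled.
Variable t : F.
Hypothesis t0 : t != 0.

Local Notation G := (gdiag (fun i => t ^+ i)).
Local Notation Gi := (gdiag (fun i => (t ^+ i)^-1)).
Local Notation Bs := (t *: As + (1 - t) *: Km).

Lemma mulGGi : G *m Gi = 1%:M.
Proof. by apply: gdiagV => i; rewrite expf_neq0. Qed.

Lemma mulGiG : Gi *m G = 1%:M.
Proof. exact: mulmx1C mulGGi. Qed.

(** Conjugation fixes the diagonal blocks and multiplies each lowering block by
    [t ^+ j.+1 / t ^+ j = t], turning [K + L] into [K + t L]. *)
Lemma Bs_conj : G *m As *m Gi = Bs.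
Proof.
apply: (res_ext rK) => i j id jd.
rewrite mulmxDr mulmxDl -!scalemxAr -!scalemxAl (res_eigl rK) // !mulmxA.
rewrite gproj_gdiag // -!scalemxAl -[_ *m Gi *m p j]mulmxA gdiag_gproj // -scalemxAr.
rewrite !scalerA; have [iE|ij] := eqVneq i j.+1.
  rewrite {}iE in id *; rewrite (res_orth rK id) //; last by lia.
  by rewrite scaler0 addr0 exprS mulfK ?expf_neq0.
rewrite gproj_As // !scalerA -scalerDl; have [->|ij'] := eqVneq i j; last first.
  by rewrite (res_orth rK) // !scaler0.
by congr (_ *: _); rewrite mulfV ?expf_neq0 //; ring.
Qed.

(** Moves the question of [A] being tridiagonal on [Es'] back to [Es], where [A] and [Ki] are both
    known to be tridiagonal. *)
Lemma A_conj : Gi *m A *m G = t *: A + (1 - t) *: Ki.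
Proof.
apply: (res_ext rK) => i j id jd.
rewrite mulmxDr mulmxDl -!scalemxAr -!scalemxAl !mulmxA !gproj_gdiag //.
rewrite -!scalemxAl -[_ *m G *m p j]mulmxA gdiag_gproj // -scalemxAr.
rewrite !scalerA; have [jE|ij] := eqVneq j i.+1.
  rewrite {}jE in jd *; rewrite (res_orth rK id) //; last by lia.
  by rewrite scaler0 addr0 exprSr mulKf ?expf_neq0.
rewrite gproj_A // !scalerA -scalerDl; have [->|ij'] := eqVneq i j; last first.
  by rewrite (res_orth rK) // !scaler0.
by congr (_ *: _); rewrite mulVf ?expf_neq0 //; ring.
Qed.

Definition Es' i : M := G *m Es i *m Gi.

Lemma perturbed_res : resolution d Bs ths Es'.
Proof. rewrite -Bs_conj; exact: res_conj mulGGi mulGiG rAs. Qed.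

Lemma Es'_neq0 i : (i <= d)%N -> Es' i != 0.
Proof.
move=> id; have := Es0 id; apply: contraNneq => e0.
have := congr1 (fun Y => Gi *m Y *m G) e0.
rewrite /Es' mulmx0 mul0mx !mulmxA mulGiG mul1mx -mulmxA mulGiG mulmx1.
by move=> ->.
Qed.

Lemma tridiagonal_Bs : tridiagonal_on d E Bs.
Proof.
move=> i j id jd ij; rewrite mulmxDr mulmxDl -!scalemxAr -!scalemxAl tA //.
by rewrite tridiagonal_K // !scaler0 addr0.
Qed.

Lemma tridiagonal_Es' : tridiagonal_on d Es' A.
Proof.
move=> i j id jd ij.
have -> : Es' i *m A *m Es' j = G *m (Es i *m (Gi *m A *m G) *m Es j) *m Gi.
  by rewrite /Es' !mulmxA.
rewrite A_conj mulmxDr mulmxDl -!scalemxAr -!scalemxAl tAs //.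
by rewrite tridiagonal_Ki // !scaler0 addr0 mulmx0 mul0mx.
Qed.

(** The right factor [Gi] disappears because the image of [Es 0] is [U_0], on which [Gi] is the
    identity. *)
Lemma Es'0E : Es' 0 = G *m Es 0%N.
Proof.
by rewrite /Es' -Es0_gproj0 mulmxA -mulmxA gproj_gdiag // expr0 invr1 scale1r.
Qed.

Lemma gproj0_Es'0 : p 0 *m Es' 0 = p 0.
Proof. by rewrite Es'0E mulmxA gproj_gdiag // scale1r gproj0_Es0. Qed.

Lemma perturbed_qSerre : qSerre q A Bs.
Proof.
exact: tridiagonal_qSerre q0 q1 thS thsS rA perturbed_res tridiagonal_Bs tridiagonal_Es'.
Qed.

(** [Es 0 *m tau i] lands in [U_i], where [G] acts as [t ^+ i]. *)
Lemma perturbed_split i chi : (i <= d)%N ->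
  Es 0%N *m tau i *m Es 0%N = chi *: Es 0%N ->
  Es' 0 *m tau i *m Es' 0 = (t ^+ i * chi) *: Es' 0.
Proof.
move=> id Echi; rewrite Es'0E.
have EsG : Es 0%N *m tau i *m G = t ^+ i *: (Es 0%N *m tau i).
  have -> : Es 0%N *m tau i = Es 0%N *m (p 0 *m tau i) *m p i.
    by rewrite -mulmxA gproj0_tau // mulmxA Es0_gproj0.
  by rewrite -[LHS]mulmxA gproj_gdiag // -scalemxAr.
have -> : G *m Es 0%N *m tau i *m (G *m Es 0%N) = G *m (Es 0%N *m tau i *m G *m Es 0%N).
  by rewrite !mulmxA.
by rewrite EsG -scalemxAl Echi scalerA -scalemxAr.
Qed.

(** * The constant [c] and irreducibility *)

Variable chi : nat -> F.
Hypothesis chiE : forall i, (i <= d)%N -> Es 0%N *m tau i *m Es 0%N = chi i *: Es 0%N.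
Let c := \sum_(i < d.+1) (\prod_(1 <= j < i.+1) (th 0%N - th j))^-1 * (t ^+ i * chi i).

(** Expand [E 0] in the [tau i] inside [Es' 0 *m E 0 *m Es' 0], then cancel the left factor [Es' 0]
    by multiplying with [p 0]. *)
Lemma E0_Es'0 : E 0%N *m Es' 0 = c *: p 0.
Proof.
have : Es' 0 *m E 0%N *m Es' 0 = c *: Es' 0.
  rewrite newton_prim_idem0 mulmx_sumr mulmx_suml /c scaler_suml; apply: eq_bigr => i _.
  by rewrite -scalemxAr -scalemxAl (perturbed_split (leq_ord i) (chiE (leq_ord i))) scalerA.
rewrite -mulmxA => /(congr1 (mulmx (p 0))).
by rewrite -scalemxAr (mulmxA _ (Es' 0)) gproj0_Es'0 (mulmxA _ (E 0%N)) gproj0_E0.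
Qed.

Lemma perturbed_irred : c != 0 -> irred_pair A Bs.
Proof.
move=> c0 W WA WBs.
pose up (i j : nat) := j == i.+1; pose down (i j : nat) := i == j.+1.
have offA i j : (i <= d)%N -> (j <= d)%N -> ~~ up i j ->
    p i *m A *m p j = th i *: (p i *m p j) by exact: gproj_A.
have offAs i j : (i <= d)%N -> (j <= d)%N -> ~~ down i j ->
    p i *m As *m p j = ths i *: (p i *m p j) by exact: gproj_As.
have pBs i j : (i <= d)%N -> p i *m Bs *m p j =
    t *: (p i *m As *m p j) + ((1 - t) * ths i) *: (p i *m p j).
  move=> id; rewrite mulmxDr mulmxDl -!scalemxAr -!scalemxAl (res_eigl rK) //.
  by rewrite -scalemxAl scalerA.
have offBs i j : (i <= d)%N -> (j <= d)%N -> ~~ down i j ->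
    p i *m Bs *m p j = ths i *: (p i *m p j).
  move=> id jd ij; rewrite pBs // offAs // scalerA -scalerDl; congr (_ *: _); ring.
have onA i j : (i <= d)%N -> (j <= d)%N -> up i j ->
    p i *m A *m p j = 1 *: (p i *m A *m p j) by rewrite scale1r.
have onBs i j : (i <= d)%N -> (j <= d)%N -> down i j ->
    p i *m Bs *m p j = t *: (p i *m As *m p j).
  move=> id jd /eqP ij; rewrite pBs // (res_orth rK id jd) ?scaler0 ?addr0 //; lia.
have upl i j k : up i j -> up k j -> k = i by move=> /eqP + /eqP; lia.
have upr i j k : up i j -> up i k -> k = j by move=> /eqP + /eqP; lia.
have downl i j k : down i j -> down k j -> k = i by move=> /eqP + /eqP; lia.
have downr i j k : down i j -> down i k -> k = j by move=> /eqP + /eqP; lia.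
have o0 := oner_neq0 F.
have [W0|W0] := eqVneq W 0; [by left; rewrite W0 submx_refl|right].
have Wp0 : W *m p 0 != 0.
  have hA := graded_hull_stable rK o0 upl offA offA onA WA.
  have hAs := graded_hull_stable rK t0 downl offBs offAs onBs WBs.
  apply/eqP => Wp; case: (irr hA hAs) => /andP[S0 S1].
    have := submx_trans (sub_graded_hull rK W) S0.
    by rewrite submx0 (negPf W0).
  have := submxMr (p 0) S1; rewrite mul1mx => /submx_trans S2.
  have /S2 : (graded_hull d p W *m p 0 <= (0 : M))%MS.
    rewrite sumsmxMr; apply/sumsmx_subP => i _; rewrite -mulmxA.
    have [i0|i0] := eqVneq (i : nat) 0%N; first by rewrite i0 (res_idem rK) // Wp.
    by rewrite (res_orth rK) ?leq_ord // mulmx0.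
  by rewrite submx0 (negPf gproj0_neq0).
have Wp0W : (W *m p 0 <= W)%MS.
  have -> : W *m p 0 = c^-1 *: (W *m E 0%N *m Es' 0).
    by rewrite -mulmxA E0_Es'0 -scalemxAr scalerA mulVf // scale1r.
  rewrite scalemx_sub //.
  (* Primitive idempotents are polynomials in their matrix, so they preserve every invariant [W]. *)
  have stab (X : M) lam : (W *m X <= W)%MS -> (W *m prim_idem X d lam 0 <= W)%MS.
    move=> WX; rewrite /prim_idem; elim/big_rec: _ => [|k Y _ WY]; first by rewrite mulmx1.
    rewrite -mulmxE mulmxA; apply: submx_trans (submxMr _ _) WY.
    by rewrite -scalemxAr scalemx_sub // mulmxBr mul_mx_scalar
      addmx_sub // eqmx_opp scalemx_sub.
  rewrite -(res_prim_idem rA) // -(res_prim_idem perturbed_res) //.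
  by apply: submx_trans (submxMr _ (stab _ _ WA)) (stab _ _ WBs).
have pA := graded_part_stable rK o0 upr offA offA onA WA.
have pAs := graded_part_stable rK t0 downr offBs offAs onBs WBs.
case: (irr pA pAs) => /andP[S0 S1].
  case/eqP: Wp0; apply/eqP; rewrite -submx0; apply: submx_trans S0.
  by rewrite (sumsmx_sup ord0) // sub_capmx Wp0W submxMl.
by rewrite submx1 /= (submx_trans S1) // graded_part_sub.
Qed.

Lemma irred_perturbed_neq0 : irred_pair A Bs -> c != 0.
Proof.
move=> irrB; apply/eqP => c0; have := E0_Es'0; rewrite c0 scale0r => EE.
have [sA sB] := flag_sum_stable rA perturbed_res tridiagonal_Bs tridiagonal_Es' 1.
case: (irrB _ sA sB) => /andP[S0 S1].
  (* [E 0 *m Es' 0 = 0] puts [E 0] in the term of index 0; every term is killed by [Es' 0], so the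
     sum is also proper. *)
  have : (E 0%N <= flag_sum d E Es' 1)%MS.
    rewrite (sumsmx_sup ord0) //; apply/(sub_flagP rA perturbed_res) => //=.
    split=> j jd; first by move=> j0; rewrite (res_orth rA) //; lia.
    by rewrite add0n ltnS leqn0 => /eqP ->.
  by move/submx_trans/(_ S0); rewrite submx0 (negPf (E0 _)).
have := submxMr (Es' 0) S1; rewrite mul1mx => /submx_trans S2.
have /S2 : (flag_sum d E Es' 1 *m Es' 0 <= (0 : M))%MS.
  rewrite sumsmxMr; apply/sumsmx_subP => i _.
  have [_ H] := (sub_flagP rA perturbed_res _ 1 (leq_ord i)).1 (submx_refl _).
  by rewrite H // addn1.
by rewrite submx0 (negPf (Es'_neq0 _)).
Qed.

End Scaled.

(** * The case [t = 0] and the equivalences *)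

Lemma irred_K_false : ~ irred_pair A Km.
Proof.
move=> irrK; have pd0 : p d != 0.
  have := E0 (leqnn d); apply: contraNneq => pd.
  by have := Ed_sub_gproj; rewrite pd submx0.
(* There is no level above [d] for [A] to raise into. *)
have pA : (p d *m A <= p d)%MS.
  rewrite [X in (X <= _)%MS](res_decr rK); apply: summx_sub => j _.
  rewrite gproj_A ?leq_ord //; last by have := leq_ord j; lia.
  have [->|dj] := eqVneq (j : nat) d; first by rewrite (res_idem rK) // scalemx_sub.
  by rewrite (res_orth rK) ?leq_ord 1?eq_sym // scaler0 sub0mx.
have pK : (p d *m Km <= p d)%MS by rewrite (res_eigl rK) // scalemx_sub.
case: (irrK _ pA pK) => /andP[S0 S1]; first by rewrite submx0 (negPf pd0) in S0.
have := submxMr (p 0) S1; rewrite mul1mx (res_orth rK) //; last by rewrite -lt0n.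
by rewrite submx0 (negPf gproj0_neq0).
Qed.

(** For abstract eigenvalue sequences, with [c] standing for the value of the Drinfel'd
    polynomial. *)
Lemma perturbed_equiv (zeta : nat -> F) (t : F) :
  split_seq d A Es th ths zeta ->
  let Bs := t *: As + (1 - t) *: Km in
  let e := prim_idem Bs d ths in
  let c := \sum_(i < d.+1) t ^+ i * zeta i /
    ((\prod_(1 <= j < i.+1) (th 0%N - th j)) *
     (\prod_(1 <= j < i.+1) (ths 0%N - ths j))) in
  [/\ TDpair A Bs <-> TDsystem d A E Bs e,
      TDsystem d A E Bs e <-> (t != 0 /\ c != 0)
    & TDsystem d A E Bs e ->
        [/\ eig_seq d A E th, eig_seq d Bs e ths,
            split_seq d A e th ths (fun i => t ^+ i * zeta i) & qSerre q A Bs]].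
Proof.
move=> hz Bs e c.
have tn0 : irred_pair A Bs -> t != 0.
  move=> irrB; apply/eqP => t0; apply: irred_K_false.
  by move: irrB; rewrite /Bs t0 scale0r add0r subr0 scale1r.
pose D i := \prod_(1 <= j < i.+1) (ths 0%N - ths j).
have D0 i : (i <= d)%N -> D i != 0.
  move=> id; rewrite prodf_seq_neq0; apply/allP => j; rewrite mem_index_iota.
  case/andP=> j0 ji; rewrite subr_eq0; apply/eqP => /inj_ths -/(_ isT) jE.
  by rewrite -jE ?(leq_trans _ id) in j0.
(* Recovers the scalar by which [tau i] acts from the split sequence. *)
pose chi i := zeta i / D i.
have chiE i : (i <= d)%N -> Es 0%N *m tau i *m Es 0%N = chi i *: Es 0%N.
  by move=> id; have [x [-> zE]] := hz i id; rewrite /chi zE mulrC mulKf ?D0.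
have cE : c = \sum_(i < d.+1) (\prod_(1 <= j < i.+1) (th 0%N - th j))^-1 * (t ^+ i * chi i).
  by apply: eq_bigr => i _; rewrite invfM /chi /D; ring.
have eE (t0 : t != 0) i : (i <= d)%N -> e i = Es' t i.
  exact: (res_prim_idem (perturbed_res t0)).
(* Irreducibility already forces [t != 0], and the remaining axioms then come from the conjugation
   by [G]. *)
have sys : irred_pair A Bs -> TDsystem d A E Bs e.
  move=> irrB; have t0 := tn0 irrB; have rB := perturbed_res t0; split=> //.
  - by split; [exact: res_diagonalizable rA|exact: res_diagonalizable rB].
  - exact: res_idem_ordering rA inj_th E0.
  - by exists ths => //; apply: (res_eig_enum rB) => // i id; exact: Es'_neq0.
  - move=> i j id jd ij; rewrite !eE //.
    by split; [exact: tridiagonal_Bs|exact: tridiagonal_Es'].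
split.
- by split=> [[_ _ _ _]|] //; exact: TDsystem_TDpair.
- split=> [[_ _ _ _ irrB]|[t0 c0]].
    by have t0 := tn0 irrB; rewrite cE; split=> //; exact: irred_perturbed_neq0.
  by apply/sys/(perturbed_irred t0 chiE); rewrite -cE.
- case=> _ _ _ _ irrB; have t0 := tn0 irrB; have rB := perturbed_res t0; split.
  + by move=> i id; rewrite (res_eigl rA).
  + by move=> i id; rewrite eE // (res_eigl rB).
  + move=> i id; exists (t ^+ i * chi i); split.
      by rewrite (eE t0) //; exact: perturbed_split (chiE i id).
    by rewrite -/(D i) /chi mulrCA [D i * _]mulrC divfK ?D0.
  + exact: perturbed_qSerre.
Qed.

End Perturbation.

(** * Powers of [q] and products of eigenvalue differences *)

Section QPowers.
Variables (F : fieldType) (q : F) (d : nat).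
Hypotheses (q0 : q != 0) (hq : forall m : nat, (0 < m)%N -> q ^+ m != 1).

Lemma exprz_inj_nroot (a b : int) : q ^ a = q ^ b -> a = b.
Proof.
wlog ab : a b / (a <= b)%R => [H E|].
  by have [|/ltW] := lerP a b => ab; [|apply/esym]; apply: H.
move=> E; have : q ^ (b - a) = 1 by rewrite expfzDr // -E -expfzDr // subrr.
rewrite -(gez0_abs (_ : 0 <= b - a)) ?subr_ge0 // -exprnP => /eqP.
by case: (posnP `|b - a|%N) => [/eqP|/hq /negPf -> //]; lia.
Qed.

(** Factor by factor, [(1 - q^(2j)) (1 - q^(-2j)) = - (q^j - q^-j)^2 = - [j]_q^2 (q - q^-1)^2],
    which is where the argument [t / (q - q^-1)^2] comes from. *)
Lemma theta_prodE i :
  (\prod_(1 <= j < i.+1) (q ^ ((2 * 0)%:Z - d%:Z) - q ^ ((2 * j)%:Z - d%:Z))) *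
  (\prod_(1 <= j < i.+1) (q ^ (d%:Z - (2 * 0)%:Z) - q ^ (d%:Z - (2 * j)%:Z))) =
  (-1) ^+ i * qfact q i ^+ 2 * (q - q^-1) ^+ 2 ^+ i.
Proof.
have qq : q - q^-1 != 0.
  rewrite subr_eq0; apply/eqP => qE; have /negP[] := hq (isT : 0 < 2)%N.
  by rewrite expr2 {1}qE mulVf.
rewrite /qfact; elim: i => [|i IH]; first by rewrite !big_geq // !expr0 expr1n !mulr1.
have th1 j : q ^ ((2 * j)%:Z - d%:Z) = q ^+ j ^+ 2 / q ^+ d.
  by rewrite expfzDr // -invr_expz -!exprnP mulnC exprM.
have th2 j : q ^ (d%:Z - (2 * j)%:Z) = q ^+ d / q ^+ j ^+ 2.
  by rewrite expfzDr // -invr_expz -!exprnP mulnC exprM.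
rewrite !(exprS _ i) !(@big_nat_recr _ _ _ i.+1 1) //= exprMn mulrACA IH.
set P := \prod_(_ <= _ < _) _.
suff -> : (q ^ ((2 * 0)%:Z - d%:Z) - q ^ ((2 * i.+1)%:Z - d%:Z)) *
  (q ^ (d%:Z - (2 * 0)%:Z) - q ^ (d%:Z - (2 * i.+1)%:Z)) =
  - (qint q i.+1 ^+ 2 * (q - q^-1) ^+ 2) by ring.
rewrite /qint -exprMn divfK // !th1 !th2 expr0 expr1n.
move: (q ^+ d) (q ^+ i.+1) (expf_neq0 d q0) (expf_neq0 i.+1 q0) => a b a0 b0.
by field; rewrite a0 b0 oner_neq0.
Qed.

End QPowers.

Theorem theorem8p9 (F : closedFieldType) (n : nat) (q : F)
  (hq0 : q != 0) (hq : forall m : nat, (0 < m)%N -> q ^+ m != 1)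
  (d : nat) (hd : (1 <= d)%N)
  (A As : 'M[F]_n.+1) (E Es : nat -> 'M[F]_n.+1)
  (hPhi : TDsystem d A E As Es)
  (hSerre : qSerre q A As)
  (hth : eig_seq d A E (fun i => q ^ ((2 * i)%:Z - d%:Z)))
  (hths : eig_seq d As Es (fun i => q ^ (d%:Z - (2 * i)%:Z)))
  (Km : 'M[F]_n.+1)
  (hK : forall i, (i <= d)%N ->
          splitU d E Es i *m Km = q ^ (d%:Z - (2 * i)%:Z) *: splitU d E Es i)
  (zeta : nat -> F)
  (hzeta : split_seq d A Es (fun i => q ^ ((2 * i)%:Z - d%:Z))
                             (fun i => q ^ (d%:Z - (2 * i)%:Z)) zeta)
  (t : F) :
  let B := A in
  let Bs := t *: As + (1 - t) *: Km in
  let Es' := fun i => prim_idem Bs d (fun j => q ^ (d%:Z - (2 * j)%:Z)) i in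
  [/\ TDpair B Bs <-> TDsystem d B E Bs Es',
      TDsystem d B E Bs Es' <->
        (t != 0 /\ (drinfeld q d zeta).[t / (q - q^-1) ^+ 2] != 0)
    & TDsystem d B E Bs Es' ->
        [/\ eig_seq d B E (fun i => q ^ ((2 * i)%:Z - d%:Z)),
            eig_seq d Bs Es' (fun i => q ^ (d%:Z - (2 * i)%:Z)),
            split_seq d B Es' (fun i => q ^ ((2 * i)%:Z - d%:Z))
                              (fun i => q ^ (d%:Z - (2 * i)%:Z))
                              (fun i => t ^+ i * zeta i)
          & qSerre q B Bs]].
Proof.
move=> B Bs Es'.
have [rA rAs [iA iAs] [tA tAs] n0] := TDsystem_resolution hPhi hth hths.
have irr : irred_pair A As by case: hPhi.
have q21 : q ^+ 2 != 1 by apply: hq.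
have thS i : q ^ ((2 * i.+1)%:Z - d%:Z) = q ^+ 2 * q ^ ((2 * i)%:Z - d%:Z).
  by rewrite exprnP -expfzDr //; congr (q ^ _); lia.
have thsS i : q ^ (d%:Z - (2 * i.+1)%:Z) = q ^- 2 * q ^ (d%:Z - (2 * i)%:Z).
  by rewrite exprnP invr_expz -expfzDr //; congr (q ^ _); lia.
have th_ths i : q ^ ((2 * i)%:Z - d%:Z) * q ^ (d%:Z - (2 * i)%:Z) = 1.
  by rewrite -expfzDr // addrA subrK subrr.
have nadj1 i j : (i <= d)%N -> (j <= d)%N -> (j.+1 < i)%N || (i.+1 < j)%N ->
    q ^ ((2 * j)%:Z - d%:Z) != q ^+ 2 * q ^ ((2 * i)%:Z - d%:Z).
  (* Equal powers would have equal exponents, giving [j = i.+1], which is excluded. *)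
  move=> _ _ ij; rewrite exprnP -expfzDr //; apply/eqP => /(exprz_inj_nroot hq0 hq); lia.
have nadj2 i j : (i <= d)%N -> (j <= d)%N -> (j.+1 < i)%N || (i.+1 < j)%N ->
    q ^ (d%:Z - (2 * j)%:Z) != q ^+ 2 * q ^ (d%:Z - (2 * i)%:Z).
  move=> _ _ ij; rewrite exprnP -expfzDr //; apply/eqP => /(exprz_inj_nroot hq0 hq); lia.
have nE i : (i <= d)%N -> E i != 0 by case/n0.
have nEs i : (i <= d)%N -> Es i != 0 by case/n0.
have -> : (drinfeld q d zeta).[t / (q - q^-1) ^+ 2] = \sum_(i < d.+1) t ^+ i * zeta i /
    ((\prod_(1 <= j < i.+1) (q ^ ((2 * 0)%:Z - d%:Z) - q ^ ((2 * j)%:Z - d%:Z))) *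
     (\prod_(1 <= j < i.+1) (q ^ (d%:Z - (2 * 0)%:Z) - q ^ (d%:Z - (2 * j)%:Z)))).
  rewrite /drinfeld horner_sum; apply: eq_bigr => i _.
  rewrite theta_prodE // hornerZ hornerXn expr_div_n !invfM.
  (* The sign moves from denominator to numerator because -1 is its own inverse. *)
  rewrite -[((-1) ^+ i)^-1]exprVn invrN1; ring.
exact: (perturbed_equiv hq0 q21 hd rA rAs iA iAs tA tAs nE nEs irr thS thsS th_ths
  nadj1 nadj2 hK t hzeta).
Qed.
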